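(* The Cayley index of $Q_8\times\mathbb{Z}_2$ is $16$, and the graph $\overline{C_4\,\square\,\overline{K_2}}\;\square\;K_2$ is an MRR for $Q_8\times\mathbb{Z}_2$ (that is, it is isomorphic to a Cayley graph $\Gamma$ on $Q_8\times\mathbb{Z}_2$ with $c(\Gamma)=c(Q_8\times\mathbb{Z}_2)=16$).
   Context: All groups and graphs are finite; graphs are simple, undirected and without loops. For a group $G$ and a subset $S\subseteq G$ with $S=S^{-1}$ and $1\notin S$, the Cayley graph $\mathrm{Cay}(G,S)$ has vertex set $G$ and edges $\{g,gs\}$ for $g\in G$, $s\in S$. The left-regular representation $L_G$ of $G$ is a subgroup of $\mathrm{Aut}(\mathrm{Cay}(G,S))$. The Cayley index of $\Gamma=\mathrm{Cay}(G,S)$ is $c(\Gamma)=|\mathrm{Aut}(\Gamma):L_G|$, and the Cayley index of the group $G$ is $c(G)=\min_S c(\mathrm{Cay}(G,S))$, the minimum over all subsets $S\subseteq G$ with $S=S^{-1}$ and $1\notin S$. If $c(G)>1$, an MRR (Most Rigid Representation) for $G$ is a Cayley graph $\Gamma$ on $G$ with $c(\Gamma)=c(G)$. $Q_8=\{\pm1,\pm i,\pm j,\pm k\}$ is the quaternion group of order $8$. $C_4$ is the cycle on $4$ vertices, $K_2$ the complete graph on $2$ vertices, $\overline{X}$ the complement of the graph $X$, and $\square$ the cartesian product of graphs: $V(\Gamma_1\square\Gamma_2)=V(\Gamma_1)\times V(\Gamma_2)$ and $(u_1,v_1)$ is adjacent to $(u_2,v_2)$ iff either $u_1=u_2$ and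 $v_1$ is adjacent to $v_2$ in $\Gamma_2$, or $v_1=v_2$ and $u_1$ is adjacent to $u_2$ in $\Gamma_1$. *)

(* Defs.v *)
From mathcomp Require Import all_boot all_fingroup all_solvable zmodp.

Set Implicit Arguments.
Unset Strict Implicit.
Unset Printing Implicit Defensive.

Local Open Scope group_scope.

(* A graph on the finite vertex type V is given by its adjacency relation, a  *)
(* symmetric and irreflexive rel V.                                           *)

Definition complete_graph n : rel 'I_n := [rel i j | i != j].

(* ordS is the cyclic successor on 'I_n; the relation is irreflexive only     *)
(* for n >= 2, and is the n-cycle for n >= 3.                                 *)
Definition cycle_graph n : rel 'I_n :=
  [rel i j | (j == ordS i) || (i == ordS j)].

Definition graph_compl (V : finType) (e : rel V) : rel V :=
  [rel x y | (x != y) && ~~ e x y].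

Definition graph_cartprod (V W : finType) (e : rel V) (f : rel W) :
    rel (V * W)%type :=
  [rel x y | (x.1 == y.1) && f x.2 y.2 || (x.2 == y.2) && e x.1 y.1].

Definition graph_isom (V W : finType) (e : rel V) (f : rel W) : Prop :=
  exists2 h : V -> W, bijective h & forall x y, f (h x) (h y) = e x y.

Definition graph_aut (V : finType) (e : rel V) : {set {perm V}} :=
  [set p : {perm V} | [forall x, forall y, e (p x) (p y) == e x y]].

Lemma graph_autP (V : finType) (e : rel V) (p : {perm V}) :
  reflect (forall x y, e (p x) (p y) = e x y) (p \in graph_aut e).
Proof. by rewrite inE; apply: (iffP 'forall_'forall_eqP). Qed.

Lemma graph_aut_group_set (V : finType) (e : rel V) : group_set (graph_aut e).
Proof.
apply/group_setP; split=> [|p q /graph_autP pP /graph_autP qP].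
  by apply/graph_autP=> x y; rewrite !perm1.
by apply/graph_autP=> x y; rewrite !permM qP pP.
Qed.
Canonical graph_aut_group (V : finType) (e : rel V) :=
  Group (graph_aut_group_set e).

Section Cayley.

Variable gT : finGroupType.
Implicit Type S : {set gT}.

Definition connection_set S : bool := (S^-1 == S) && (1 \notin S).

Definition cayley_graph S : rel gT := [rel g h | [exists s in S, h == g * s]].

Definition left_mul_perm (g : gT) : {perm gT} := perm (@mulgI gT g).

Definition left_regular : {set {perm gT}} := [set left_mul_perm g | g : gT].

Definition cayley_graph_index S : nat :=
  #|graph_aut (cayley_graph S) : left_regular|.

(* The minimum over all connection sets; the base point set0 of the arg min   *)
(* is always a connection set, see connection_set0 below.                     *)
Definition cayley_index : nat :=
  cayley_graph_index
    [arg min_(S < set0 | connection_set S) cayley_graph_index S].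

(* Most rigid representation of gT, up to graph isomorphism. *)
Definition is_MRR (V : finType) (e : rel V) : Prop :=
  1 < cayley_index /\
  exists S, [/\ connection_set S, graph_isom e (cayley_graph S)
              & cayley_graph_index S = cayley_index].

Lemma connection_set0 : connection_set set0.
Proof.
by rewrite /connection_set inE andbT; apply/eqP/setP=> x; rewrite mem_invg !inE.
Qed.

Lemma cayley_index_spec :
  (exists2 S, connection_set S & cayley_graph_index S = cayley_index) /\
  (forall S, connection_set S -> cayley_index <= cayley_graph_index S).
Proof.
rewrite /cayley_index; case: arg_minnP => [|S SP minS].
  exact: connection_set0.
by split=> [|T /minS//]; exists S.
Qed.

Lemma cayley_graph_sym S : connection_set S -> symmetric (cayley_graph S).
Proof.
case/andP=> /eqP SV _ g h /=; apply/exists_inP/exists_inP=> -[s sS /eqP->];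
  by exists s^-1; rewrite ?mulgK // -mem_invg SV.
Qed.

Lemma cayley_graph_irr S : connection_set S -> irreflexive (cayley_graph S).
Proof.
case/andP=> _ S1 g /=; apply/exists_inP=> -[s sS].
by rewrite -{1}[g]mulg1 (inj_eq (mulgI g)) => /eqP s1; rewrite s1 sS in S1.
Qed.

Lemma left_regular_group_set : group_set left_regular.
Proof.
apply/group_setP; split=> [|_ _ /imsetP[g _ ->] /imsetP[h _ ->]].
  by apply/imsetP; exists 1 => //; apply/permP=> x; rewrite perm1 permE mul1g.
apply/imsetP; exists (h * g) => //.
by apply/permP=> x; rewrite permM !permE mulgA.
Qed.
Canonical left_regular_group := Group left_regular_group_set.

Lemma left_regular_sub_aut S : left_regular \subset graph_aut (cayley_graph S).
Proof.
apply/subsetP=> _ /imsetP[g _ ->]; apply/graph_autP=> x y /=.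
by apply: eq_existsb => s; rewrite !permE -mulgA (inj_eq (mulgI g)).
Qed.

End Cayley.

Arguments cayley_index gT : clear implicits.
Arguments is_MRR gT {V} e.
Arguments left_regular gT : clear implicits.

(* Main.v *)
Require Import Defs.
From mathcomp Require Import all_boot all_fingroup all_solvable zmodp.
From HB Require Import structures.

(** The index of L_G in the automorphism group of Cay(G, S) is the order of the
    stabiliser of the vertex 1, so the claim is that this stabiliser has order at
    least 16 for every connection set S of G = Q8 x Z2, and order 16 for the
    connection set {-1, j, -j, k, -k, t}, where t generates Z2.

    Lower bound. Every conjugate of x in G is x or x^-1, and G is not abelian.
    Hence the inner automorphisms (4 of them, as the centre has index 4) and the
    inversion x -> x^-1, which is not inner, generate at least 8 permutations
    that fix 1, stabilise every class {x, x^-1}, and are automorphisms of every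
    Cayley graph on G. Any automorphism of the group G that preserves S and moves
    some class {x, x^-1} therefore raises the order of the stabiliser to at least
    16 ([cayley_index_hamiltonian]). Such an automorphism always exists
    ([extra_aut]): for each axis u = i, j, k, the set S contains u and u t, or
    neither, or exactly one; two axes agree on whether it is exactly one, and a
    combination of exchanging these axes and multiplying them by t preserves S.

    Upper bound. For the special S, an automorphism is a branch of a backtracking
    search over the 16 vertices, and the search has 256 leaves ([card_aut_mrr]),
    so that the index is at most 256 / 16 = 16. The graph is the required one
    because the cosets of <i> in Q8 are the two 4-cycles of the cartesian product
    of C4 with the complement of K2, {-1, j, -j, k, -k} is the set of elements of
    Q8 other than 1, i and -i, and t gives the factor K2
    ([mrr_graph_isom]). All computations are made in a boolean model of G, and
    carried to G by [is_MRR_iso]. *)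

Set Implicit Arguments.
Unset Strict Implicit.
Unset Printing Implicit Defensive.

Local Open Scope group_scope.

(** * Graph isomorphisms and automorphism counts *)

Section GraphIsomorphism.

Variables V W : finType.
Implicit Types (e : rel V) (f : rel W).

Lemma graph_isom_sym e f : graph_isom e f -> graph_isom f e.
Proof.
case=> h [k hK kK] hP; exists k; first by exists h.
by move=> x y; rewrite -hP !kK.
Qed.

Lemma graph_isom_trans (U : finType) (d : rel U) e f :
  graph_isom d e -> graph_isom e f -> graph_isom d f.
Proof.
case=> h bij_h hP [k bij_k kP]; exists (k \o h); first exact: bij_comp.
by move=> x y; rewrite /= kP hP.
Qed.

(** Conjugation by an isomorphism embeds one automorphism group in the other. *)
Lemma leq_card_graph_aut e f :
  graph_isom e f -> #|graph_aut e| <= #|graph_aut f|.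
Proof.
case=> h [k hK kK] hP.
have inj_conj (p : {perm V}) : injective (h \o p \o k).
  by apply: inj_comp (can_inj kK); apply: inj_comp (can_inj hK) perm_inj.
pose c p := perm (inj_conj p).
have c_inj : injective c.
  move=> p q /permP eq_c; apply/permP=> x; apply: (can_inj hK).
  by have:= eq_c (h x); rewrite !permE /= hK.
rewrite -(card_imset _ c_inj); apply/subset_leq_card/subsetP.
move=> _ /imsetP[p /graph_autP pP ->]; apply/graph_autP=> x y.
by rewrite !permE /= hP pP -hP !kK.
Qed.

End GraphIsomorphism.

Lemma eq_card_graph_aut (V W : finType) (e : rel V) (f : rel W) :
  graph_isom e f -> #|graph_aut e| = #|graph_aut f|.
Proof.
move=> ef; apply/eqP; rewrite eqn_leq leq_card_graph_aut //.
exact/leq_card_graph_aut/graph_isom_sym.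
Qed.

(** * Bounding an automorphism group by exhaustive search *)

Section Search.

Variables (V : eqType) (e : rel V) (dom : seq V).

(** Backtracking search: [done] records the images chosen so far, and the next
    point of [todo] may go to any new point that has the same adjacencies to
    these images. *)
Fixpoint embeddings (done : seq (V * V)) (todo : seq V) : seq (seq V) :=
  if todo is u :: todo' then
    flatten [seq embeddings ((u, v) :: done) todo'
            | v <- dom & all (fun q => (q.2 != v) && (e q.2 v == e q.1 u)) done]
  else [:: [seq q.2 | q <- done]].

(** An automorphism is a branch that is never pruned. *)
Lemma mem_embeddings (p : V -> V) (done todo : seq V) :
    injective p -> (forall x y, e (p x) (p y) = e x y) ->
    (forall x, p x \in dom) -> uniq (catrev todo done) ->
  [seq p u | u <- catrev todo done]
     \in embeddings [seq (u, p u) | u <- done] todo.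
Proof.
move=> p_inj pP p_dom; elim: todo done => [|u todo IH] done /= uniq_s.
  by rewrite mem_seq1 -map_comp.
apply/flatten_mapP; exists (p u); last exact: (IH (u :: done)).
rewrite mem_filter p_dom andbT all_map; apply/allP=> v done_v /=.
rewrite pP eqxx (inj_eq p_inj) andbT; apply: contraTneq uniq_s => <-.
by rewrite catrevE cat_uniq /= done_v /= !andbF.
Qed.

End Search.

(** An automorphism is determined by its branch once [s] lists every vertex,
    so the number of leaves bounds the number of automorphisms. *)
Lemma card_graph_aut_search (V : finType) (e : rel V) (s : seq V) :
  uniq s -> (forall x, x \in s) -> #|graph_aut e| <= size (embeddings e s [::] s).
Proof.
move=> uniq_s s_full.
rewrite cardE -(size_map (fun p : {perm V} => [seq p u | u <- rev s])).
apply: uniq_leq_size => [|t /mapP[p]].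
  rewrite map_inj_uniq ?enum_uniq // => p q /eq_in_map eq_pq.
  by apply/permP=> x; rewrite eq_pq // mem_rev.
rewrite mem_enum => /graph_autP pP ->.
apply: (mem_embeddings (done := [::])) => //; first exact: perm_inj.
by rewrite -[catrev _ _]/(rev s) rev_uniq.
Qed.

(** * The Cayley index as the order of a vertex stabiliser *)

Section CayleyIndexBound.

Variable gT : finGroupType.
Implicit Types (S : {set gT}) (g h x : gT).

Lemma cayley_graphE S g h : cayley_graph S g h = (g^-1 * h \in S).
Proof.
apply/exists_inP/idP=> [[s sS /eqP->] | ghS]; first by rewrite mulKg.
by exists (g^-1 * h); rewrite // mulKVg.
Qed.

Lemma card_left_regular : #|left_regular gT| = #|gT|.
Proof.
rewrite card_imset ?cardsT // => g h /permP/(_ 1).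
by rewrite !permE !mulg1.
Qed.

Lemma cayley_graph_index_mul S :
  (#|gT| * cayley_graph_index S)%N = #|graph_aut (cayley_graph S)|.
Proof.
by rewrite -card_left_regular /cayley_graph_index Lagrange ?left_regular_sub_aut.
Qed.

(** The left-regular group meets the stabiliser of 1 trivially, so a group [M]
    of automorphisms fixing 1 contributes the |G||M| automorphisms of L_G M. *)
Lemma leq_card_cayley_index (M : {group {perm gT}}) S :
    M \subset graph_aut (cayley_graph S) :&: 'C[1 | 'P] ->
  #|M| <= cayley_graph_index S.
Proof.
rewrite subsetI => /andP[MA /subsetP M1].
have tiLM : left_regular_group gT :&: M = 1.
  apply/trivgP/subsetP=> _ /setIP[/imsetP[g _ ->] /M1/astab1P].
  rewrite /= apermE permE mulg1 => ->; rewrite inE.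
  by apply/eqP/permP=> x; rewrite permE mul1g perm1.
rewrite -(leq_pmul2l (_ : 0 < #|gT|)); last by apply/card_gt0P; exists 1.
rewrite cayley_graph_index_mul -card_left_regular.
rewrite -(TI_cardMg tiLM) subset_leq_card // mul_subG //.
exact: left_regular_sub_aut.
Qed.

Lemma double_proper_card (A B : {group gT}) : A \proper B -> 2 * #|A| <= #|B|.
Proof.
move=> ltAB; rewrite -(Lagrange (proper_sub ltAB)) mulnC leq_pmul2l //.
by rewrite indexg_gt1 proper_subn.
Qed.

End CayleyIndexBound.

(** * Groups in which every conjugate of x is x or its inverse *)

Section HamiltonianBound.

Variable gT : finGroupType.
Implicit Types (S : {set gT}) (g h x : gT).

Definition inn_perms : {group {perm gT}} := (actperm 'J @* [set: gT])%G.

Lemma inn_permsP (p : {perm gT}) :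
  reflect (exists g, forall x, p x = x ^ g) (p \in inn_perms).
Proof.
apply: (iffP morphimP) => [[g _ _ ->] | [g pE]].
  by exists g => x; rewrite actpermE.
by exists g; rewrite ?inE //; apply/permP=> x; rewrite actpermE pE.
Qed.

Lemma card_inn_perms : #|inn_perms| = #|[set: gT] : 'Z([set: gT])|.
Proof.
by rewrite card_morphim ker_actperm astabJ setIid -indexgI.
Qed.

Definition inv_perm : {perm gT} := perm (@invg_inj gT).

(** The permutations that stabilise each inverse class {x, x^-1}. *)
Definition class_perms : {set {perm gT}} :=
  [set p : {perm gT} | [forall x, (p x == x) || (p x == x^-1)]].

Lemma class_permsP (p : {perm gT}) :
  reflect (forall x, p x = x \/ p x = x^-1) (p \in class_perms).
Proof.
rewrite inE; apply: (iffP forallP) => pP x.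
  by case/orP: (pP x) => /eqP; [left | right].
by case: (pP x) => ->; rewrite eqxx ?orbT.
Qed.

Lemma class_perms_group_set : group_set class_perms.
Proof.
apply/group_setP; split=> [|p q /class_permsP pP /class_permsP qP].
  by apply/class_permsP=> x; left; rewrite perm1.
apply/class_permsP=> x; rewrite permM.
case: (pP x) => ->; first exact: qP.
by case: (qP x^-1) => ->; rewrite ?invgK; auto.
Qed.
Canonical class_perms_group := Group class_perms_group_set.

Hypothesis conj_class : forall g x, x ^ g = x \/ x ^ g = x^-1.
Hypothesis nonabelian : ~~ abelian [set: gT].

Lemma inn_perms_sub_class : inn_perms \subset class_perms.
Proof.
apply/subsetP=> p /inn_permsP[g pE].
by apply/class_permsP=> x; rewrite pE.
Qed.

Lemma inv_perm_class : inv_perm \in class_perms.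
Proof. by apply/class_permsP=> x; right; rewrite permE. Qed.

(** An inversion that is inner is multiplicative, which forces commutativity. *)
Lemma inv_perm_not_inn : inv_perm \notin inn_perms.
Proof.
apply: contra nonabelian => /inn_permsP[g invE]; apply/centsP=> x _ y _.
have conjVE z : z^-1 = z ^ g by rewrite -invE permE.
by apply: invg_inj; rewrite !conjVE conjMg -!conjVE invMg.
Qed.

Lemma memV_connection S x : connection_set S -> (x^-1 \in S) = (x \in S).
Proof. by case/andP=> /eqP SV _; rewrite -[in LHS]SV mem_invg invgK. Qed.

Lemma stab_aut S (p : {perm gT}) :
    p 1 = 1 -> (forall x y, ((p x)^-1 * p y \in S) = (x^-1 * y \in S)) ->
  p \in graph_aut (cayley_graph S) :&: 'C[1 | 'P].
Proof.
move=> p1 pP; rewrite inE; apply/andP; split; last by apply/astab1P.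
by apply/graph_autP=> x y; rewrite !cayley_graphE pP.
Qed.

(** The stabiliser of 1 contains the chain Inn < <Inn, inversion> <
    <Inn, inversion, a>, and each proper inclusion at least doubles the order.
    The first is proper because G is not abelian, the second because the middle
    group consists of elements of [class_perms]. Inner automorphisms preserve S
    since S is a union of inverse classes; inversion preserves adjacency since
    x * y^-1 and x^-1 * y belong, up to conjugation, to one inverse class. *)
Theorem cayley_index_hamiltonian S (a : {perm gT}) :
    connection_set S -> {morph a : x y / x * y} ->
    (forall x, (a x \in S) = (x \in S)) -> a \notin class_perms ->
  4 * #|[set: gT] : 'Z([set: gT])| <= cayley_graph_index S.
Proof.
move=> connS aM aS a_class.
have morph1 (p : {perm gT}) : {morph p : x y / x * y} -> p 1 = 1.
  by move=> pM; apply: (mulgI (p 1)); rewrite -pM !mulg1.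
have morph_stab (p : {perm gT}) : {morph p : x y / x * y} ->
    (forall x, (p x \in S) = (x \in S)) ->
    p \in graph_aut (cayley_graph S) :&: 'C[1 | 'P].
  move=> pM pS; have p1 := morph1 p pM; apply: stab_aut => // x y.
  rewrite -[RHS]pS pM; congr (_ * _ \in S); apply: (mulgI (p x)).
  by rewrite -pM !mulgV.
pose flips := (inn_perms <*> <[inv_perm]>)%G.
pose stab := (flips <*> <[a]>)%G.
have inn_flips : inn_perms \proper flips.
  rewrite properE joing_subl join_subG subxx cycle_subG inv_perm_not_inn //.
have flips_class : flips \subset class_perms.
  by rewrite join_subG inn_perms_sub_class cycle_subG inv_perm_class.
have flips_stab : flips \proper stab.
  rewrite properE joing_subl join_subG subxx cycle_subG.
  by apply: contra a_class; apply: subsetP.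
have stabP : stab \subset graph_aut (cayley_graph S) :&: 'C[1 | 'P].
  rewrite !join_subG !cycle_subG; apply/andP; split; last exact: morph_stab.
  apply/andP; split.
    apply/subsetP=> p /inn_permsP[g pE]; apply: morph_stab => [x y | x].
      by rewrite !pE conjMg.
    by rewrite pE; case: (conj_class g x) => ->; rewrite ?memV_connection.
  apply: stab_aut => [|x y]; rewrite !permE ?invg1 // invgK.
  have -> : x * y^-1 = (y^-1 * x) ^ x^-1 by rewrite conjgE invgK !mulgA mulgK.
  rewrite -[RHS]memV_connection // invMg invgK.
  by case: (conj_class x^-1 (y^-1 * x)) => ->; rewrite ?memV_connection.
apply: leq_trans (leq_card_cayley_index stabP).
apply: leq_trans (double_proper_card flips_stab).
by rewrite -card_inn_perms -[4]/(2 * 2)%N -mulnA leq_mul2l double_proper_card.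
Qed.

End HamiltonianBound.

(** * Invariance under group isomorphism *)

Section Transport.

Variables (gT hT : finGroupType) (f : gT -> hT).
Hypotheses (bij_f : bijective f) (fM : {morph f : x y / x * y}).

Lemma morph_invg : {morph f : x / x^-1}.
Proof.
move=> x; have f1 : f 1 = 1 by apply: (mulgI (f 1)); rewrite -fM !mulg1.
by apply: (mulgI (f x)); rewrite -fM !mulgV.
Qed.

Lemma connection_set_imset S : connection_set S -> connection_set (f @: S).
Proof.
have inj_f := bij_inj bij_f.
have f1 : f 1 = 1 by apply: (mulgI (f 1)); rewrite -fM !mulg1.
case/andP=> /eqP SV S1; rewrite /connection_set -[1]f1 mem_imset // S1 andbT.
apply/eqP/setP=> y; have [g fK gK] := bij_f.
by rewrite mem_invg -[y]gK -morph_invg !mem_imset // -[in RHS]SV mem_invg.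
Qed.

Lemma cayley_graph_imset (S : {set gT}) :
  graph_isom (cayley_graph S) (cayley_graph (f @: S)).
Proof.
exists f => // x y; rewrite !cayley_graphE -morph_invg -fM mem_imset //.
exact: bij_inj.
Qed.

Lemma cayley_graph_index_imset (S : {set gT}) :
  cayley_graph_index (f @: S) = cayley_graph_index S.
Proof.
have gT_gt0 : 0 < #|gT| by apply/card_gt0P; exists 1.
apply/eqP; rewrite -(eqn_pmul2l gT_gt0).
rewrite cayley_graph_index_mul (bij_eq_card bij_f) cayley_graph_index_mul.
by rewrite (eq_card_graph_aut (cayley_graph_imset S)).
Qed.

Lemma leq_cayley_index_iso : cayley_index hT <= cayley_index gT.
Proof.
have [[S connS <-] _] := cayley_index_spec gT.
have [_ min_hT] := cayley_index_spec hT.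
by rewrite -cayley_graph_index_imset min_hT // connection_set_imset.
Qed.

End Transport.

Lemma eq_cayley_index_iso (gT hT : finGroupType) (f : gT -> hT) :
  bijective f -> {morph f : x y / x * y} -> cayley_index hT = cayley_index gT.
Proof.
move=> bij_f fM; apply/eqP; rewrite eqn_leq (leq_cayley_index_iso bij_f fM) /=.
have [g fK gK] := bij_f; apply: (leq_cayley_index_iso (f := g)).
  by exists f.
by move=> x y; rewrite -[x in LHS]gK -[y in LHS]gK -fM fK.
Qed.

Lemma is_MRR_iso (gT hT : finGroupType) (f : gT -> hT)
    (V : finType) (e : rel V) :
  bijective f -> {morph f : x y / x * y} -> is_MRR gT e -> is_MRR hT e.
Proof.
move=> bij_f fM [c_gt1 [S [connS isomS indexS]]].
rewrite /is_MRR (eq_cayley_index_iso bij_f fM); split=> //; exists (f @: S).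
rewrite connection_set_imset // cayley_graph_index_imset //; split=> //.
exact/(graph_isom_trans isomS)/cayley_graph_imset.
Qed.

(** * A computable model of Q8 x Z2 *)

(** The tuple (s, a, b, c) stands for (-1)^s i^a j^b t^c, with t the generator of
    Z2. Products are then given by a cocycle: the sign collects i^2 = -1,
    j^2 = -1 and ji = -ij. Being computable on booleans, this model lets
    identities be checked by evaluation, unlike ['Q_8], which is a locked
    quotient. *)
Definition Q8xZ2 : Type := (bool * bool * bool * bool)%type.
HB.instance Definition _ := Finite.on Q8xZ2.

Definition quat (s a b c : bool) : Q8xZ2 := (s, a, b, c).

Local Notation qi := (quat false true false false).
Local Notation qj := (quat false false true false).
Local Notation qt := (quat false false false true).

Definition quat_mul (u v : Q8xZ2) : Q8xZ2 :=
  let: (s, a, b, c) := u in let: (s', a', b', c') := v in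
  quat (s (+) s' (+) (a && a') (+) (b && b') (+) (b && a'))
       (a (+) a') (b (+) b') (c (+) c').

Definition quat_inv (u : Q8xZ2) : Q8xZ2 :=
  let: (s, a, b, c) := u in quat (s (+) (a || b)) a b c.

Lemma quat_mulA : associative quat_mul.
Proof.
move=> [[[s1 a1] b1] c1] [[[s2 a2] b2] c2] [[[s3 a3] b3] c3].
congr quat; [|exact: addbA ..].
by case: s1 s2 s3 a1 a2 a3 b1 b2 b3 => [] [] [] [] [] [] [] [] [].
Qed.

Lemma quat_mul1 : left_id (quat false false false false) quat_mul.
Proof. by case=> [[[[] []] []] []]. Qed.

Lemma quat_mulV : left_inverse (quat false false false false) quat_inv quat_mul.
Proof. by case=> [[[[] []] []] []]. Qed.

HB.instance Definition _ :=
  Finite_isGroup.Build Q8xZ2 quat_mulA quat_mul1 quat_mulV.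

Lemma quat_conj_class (g x : Q8xZ2) : x ^ g = x \/ x ^ g = x^-1.
Proof.
by apply/pred2P; move: g x; do 2![case=> [[[[] []] []] []]].
Qed.

Lemma quat_nonabelian : ~~ abelian [set: Q8xZ2].
Proof.
apply/negP=> /centsP/(_ qi (in_setT _)); by move/(_ qj (in_setT _)).
Qed.

Lemma card_quat : #|{: Q8xZ2}| = 16.
Proof.
rewrite [LHS](card_prod (bool * bool * bool)%type bool).
by rewrite !card_prod card_bool.
Qed.

Lemma index_quat_center : #|[set: Q8xZ2] : 'Z([set: Q8xZ2])| = 4.
Proof.
rewrite -divgS ?center_sub //= cardsT card_quat.
pose z (d : bool * bool) := quat d.1 false false d.2.
have z_inj : injective z by case=> [s c] [s' c'] [-> ->].
have -> : 'Z([set: Q8xZ2]) = z @: [set: bool * bool].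
  apply/setP=> u; rewrite inE in_setT /=.
  apply/centP/imsetP=> [cu | [d _ ->] v _].
    have := cu qi (in_setT _).
    have := cu qj (in_setT _).
    case: u {cu} => [[[s a] b] c] cj ci; exists (s, c); rewrite ?inE //.
    by case: s a b c ci cj => [] [] [] [].
  by move: d v; case=> [[] []]; case=> [[[[] []] []] []].
by rewrite card_imset // cardsT card_prod card_bool.
Qed.

(** * Extra automorphisms preserving a connection set *)

(** The automorphism i -> j -> ij -> i of Q8, fixing t. *)
Definition quat_rot (u : Q8xZ2) : Q8xZ2 :=
  let: (s, a, b, c) := u in quat s b (a (+) b) c.

(** [swap] exchanges i and j (so that ij goes to -ij); [twist] multiplies i and
    j by t, and fixes ij. *)
Definition quat_pair (swap twist : bool) (u : Q8xZ2) : Q8xZ2 :=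
  let: (s, a, b, c) := u in
  quat (s (+) (swap && a && b)) (if swap then b else a) (if swap then a else b)
       (c (+) (twist && (a (+) b))).

Lemma quat_rotM : {morph quat_rot : u v / u * v}.
Proof. by do 2![case=> [[[[] []] []] []]]. Qed.

Lemma quat_rotK : cancel quat_rot (quat_rot \o quat_rot).
Proof. by case=> [[[[] []] []] []]. Qed.

Lemma quat_pairM swap twist : {morph quat_pair swap twist : u v / u * v}.
Proof. by case: swap twist => [] []; do 2![case=> [[[[] []] []] []]]. Qed.

Lemma quat_pairK swap twist : involutive (quat_pair swap twist).
Proof. by case: swap twist => [] []; case=> [[[[] []] []] []]. Qed.

Definition has_extra_aut (S : {set Q8xZ2}) : Prop :=
  exists a : {perm Q8xZ2}, [/\ {morph a : u v / u * v},
    forall u, (a u \in S) = (u \in S) & a \notin class_perms Q8xZ2].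

(** Whether S contains both or neither of u and u t, where u = i^a j^b. *)
Definition twist_inv (S : {set Q8xZ2}) (a b : bool) : bool :=
  (quat false a b false \in S) == (quat false a b true \in S).

(** Whether a non-central element lies in S does not depend on its sign, so only
    the pairs of bits (u \in S, u t \in S) matter for u = i, j. If both pairs are
    constant, [twist] preserves S. If both are non-constant, they are equal, and
    [swap] preserves S, or opposite, and [swap] with [twist] does. Neither the
    central elements nor the classes of ij and ij t are moved. *)
Lemma extra_aut_pair (S : {set Q8xZ2}) :
    connection_set S -> twist_inv S true false = twist_inv S false true ->
  has_extra_aut S.
Proof.
rewrite /twist_inv => connS eq_ij.
have sgnS a b c : a || b -> (quat true a b c \in S) = (quat false a b c \in S).
  by move=> ab1; rewrite -(memV_connection _ connS) /=; case: a b ab1 => [] [].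
have sgnI c := sgnS true false c isT.
have sgnJ c := sgnS false true c isT.
have sgnK c := sgnS true true c isT.
pose i_sym := twist_inv S true false.
pose swap := ~~ i_sym.
pose twist := i_sym || ((qi \in S) != (qj \in S)).
exists (perm (can_inj (quat_pairK swap twist))); split=> [u v | u |].
- by rewrite !permE quat_pairM.
- move: eq_ij; rewrite permE /twist /swap /i_sym /twist_inv.
  case i0: (qi \in S); case i1: (quat _ true false true \in S);
  case j0: (qj \in S); case j1: (quat _ false true true \in S) => //= _;
  case: u => [[[[] []] []] []] //=;
  by rewrite ?sgnI ?sgnJ ?sgnK ?i0 ?i1 ?j0 ?j1.
- apply/negP=> /class_permsP/(_ qi).
  by rewrite permE /twist /swap /i_sym; case: (twist_inv S true false) => -[].
Qed.

(** The relevant automorphism is transported by conjugation with the rotation. *)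
Lemma extra_aut_rot (S : {set Q8xZ2}) :
  has_extra_aut (quat_rot @^-1: S) -> has_extra_aut S.
Proof.
case=> a [aM aS a_class]; pose r := perm (can_inj quat_rotK).
have rM : {morph r : u v / u * v} by move=> u v; rewrite !permE quat_rotM.
have rVM : {morph r^-1 : u v / u * v}.
  by move=> u v; apply: (@perm_inj _ r); rewrite rM !permKV.
have rS u : (r u \in S) = (u \in quat_rot @^-1: S) by rewrite inE permE.
exists (a ^ r); split=> [u v | u |].
- by rewrite !permM rVM aM rM.
- by rewrite !permM rS aS -rS permKV.
apply: contra a_class => /class_permsP aP; apply/class_permsP=> u.
have := aP (r u); rewrite permJ -(morph_invg rM).
by case=> /perm_inj; [left | right].
Qed.

Lemma connection_set_rot (S : {set Q8xZ2}) :
  connection_set S -> connection_set (quat_rot @^-1: S).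
Proof.
have -> : quat_rot @^-1: S = (quat_rot \o quat_rot) @: S.
  apply/setP=> u; rewrite inE -[in RHS](quat_rotK u) mem_imset //.
  by apply: inj_comp; apply: can_inj quat_rotK.
apply: connection_set_imset => [|u v]; last by rewrite /= !quat_rotM.
by exists quat_rot => u; [|]; exact: quat_rotK.
Qed.

(** Pigeonhole: among the three axes i, j and ij, two agree under [twist_inv],
    and rotating brings these two to i and j. *)
Lemma extra_aut (S : {set Q8xZ2}) : connection_set S -> has_extra_aut S.
Proof.
move=> connS; have connS1 := connection_set_rot connS.
have connS2 := connection_set_rot connS1.
have rotS (T : {set Q8xZ2}) a b :
    twist_inv (quat_rot @^-1: T) a b = twist_inv T b (a (+) b).
  by rewrite /twist_inv !inE.
have := extra_aut_pair connS; have := extra_aut_pair connS1.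
have := extra_aut_pair connS2; rewrite !rotS /=.
case: (twist_inv S true false); case: (twist_inv S false true);
  case: (twist_inv S true true) => e2 e1 e0.
all: by [exact: e0 | exact/extra_aut_rot/e1
        | exact/extra_aut_rot/extra_aut_rot/e2].
Qed.

Lemma geq16_cayley_graph_index (S : {set Q8xZ2}) :
  connection_set S -> 16 <= cayley_graph_index S.
Proof.
move=> connS; have [a [aM aS a_class]] := extra_aut connS.
rewrite -[16]/(4 * 4)%N -{2}index_quat_center.
exact: (cayley_index_hamiltonian quat_conj_class quat_nonabelian connS aM aS).
Qed.

(** * The connection set of the rigid graph *)

(** Membership in {-1, j, -j, ij, -ij, t}. On Q8 the complementary Cayley graph has
    connection set {i, -i} and consists of two disjoint 4-cycles, the left cosets
    of <i>; t adds the factor K2. *)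
Definition mrr_conn (u : Q8xZ2) : bool :=
  let: (s, a, b, c) := u in
  if c then ~~ [|| s, a | b] else b || (s && ~~ a).

Definition mrr_set : {set Q8xZ2} := [set u | mrr_conn u].

(** The boolean test keeps the search executable. *)
Definition mrr_adj : rel Q8xZ2 := [rel u v | mrr_conn (u^-1 * v)].

Lemma mrr_set_connection : connection_set mrr_set.
Proof.
rewrite /connection_set inE andbT; apply/eqP/setP=> u.
by rewrite mem_invg !inE; move: u; case=> [[[[] []] []] []].
Qed.

Lemma mrr_adj_isom : graph_isom mrr_adj (cayley_graph mrr_set).
Proof. by exists id => [|u v]; [exists id | rewrite cayley_graphE inE]. Qed.

(** The coset j^k <i> t^c, listed in the order of its 4-cycle. *)
Definition quat_coset (k c : bool) : seq Q8xZ2 :=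
  [seq quat false false k c * qi ^+ m | m <- iota 0 4].

Definition quat_enum : seq Q8xZ2 :=
  quat_coset false false ++ quat_coset true false
    ++ quat_coset false true ++ quat_coset true true.

(** The value 256 is 2 * 128: the factor 2 exchanges the ends of K2, and 128 is
    the order of the automorphism group of two disjoint 4-cycles. *)
Lemma card_aut_mrr : #|graph_aut mrr_adj| <= 256.
Proof.
have <- : size (embeddings mrr_adj quat_enum [::] quat_enum) = 256.
  by vm_compute.
apply: card_graph_aut_search; first by vm_compute.
by case=> [[[[] []] []] []].
Qed.

Lemma cayley_graph_index_mrr : cayley_graph_index mrr_set = 16.
Proof.
apply/eqP; rewrite eqn_leq geq16_cayley_graph_index ?mrr_set_connection // andbT.
rewrite -(leq_pmul2l (isT : 0 < 16)) -{1}card_quat cayley_graph_index_mul.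
by rewrite -(eq_card_graph_aut mrr_adj_isom) card_aut_mrr.
Qed.

Lemma cayley_index_quat : cayley_index Q8xZ2 = 16.
Proof.
have [[S connS indexS] min_index] := cayley_index_spec Q8xZ2.
apply/eqP; rewrite eqn_leq -{2}indexS geq16_cayley_graph_index // andbT.
by rewrite -cayley_graph_index_mrr min_index ?mrr_set_connection.
Qed.

(** The vertex at position m of the k-th 4-cycle and end l of K2 is j^k i^m t^l;
    right multiplication by i or -i moves along the 4-cycle. *)
Definition mrr_label (v : 'I_4 * 'I_2 * 'I_2) : Q8xZ2 :=
  qj ^+ v.1.2 * qi ^+ v.1.1 * qt ^+ v.2.

Lemma mrr_graph_isom :
  graph_isom
    (graph_cartprod
       (graph_compl
          (graph_cartprod (@cycle_graph 4) (graph_compl (@complete_graph 2))))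
       (@complete_graph 2))
    (cayley_graph mrr_set).
Proof.
apply: graph_isom_trans mrr_adj_isom.
exists mrr_label.
  apply: inj_card_bij; last by rewrite card_quat !card_prod !card_ord.
  case=> [[[[|[|[|[|//]]]] lem] [[|[|//]] lek]] [[|[|//]] lel]];
  case=> [[[[|[|[|[|//]]]] lem'] [[|[|//]] lek']] [[|[|//]] lel']] //= _;
  by congr (_, _, _); apply: val_inj.
(* The two adjacencies are evaluated on all pairs of vertices. *)
case=> [[[[|[|[|[|//]]]] lem] [[|[|//]] lek]] [[|[|//]] lel]];
case=> [[[[|[|[|[|//]]]] lem'] [[|[|//]] lek']] [[|[|//]] lel']].
all: by [].
Qed.

(** * Identification with Q8 x Z2 *)

Definition quat_to (x y : 'Q_8) (u : Q8xZ2) : 'Q_8 * 'Z_2 :=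
  let: (s, a, b, c) := u in ((x ^+ 2) ^+ s * x ^+ a * y ^+ b, inZp c : 'Z_2).

(** Generators x and y of ['Q_8] with y^2 = x^2 and x^y = x^-1 play the parts of
    i and j, with z = x^2 as -1. The kernel is trivial because y is not a power
    of x and x has order 4; both sides have order 16. *)
Lemma quat_iso : exists2 f : Q8xZ2 -> 'Q_8 * 'Z_2,
  bijective f & {morph f : u v / u * v}.
Proof.
have [//|[x y] [oQ _ ox /setDP[_ X'y]] [_ y2 xy]] :=
  generators_quaternion (n := 3) _ (isog_refl [set: 'Q_8]).
rewrite /= in oQ ox y2.
pose z := x ^+ 2; have y2z : y ^+ 2 = z := y2.
have z2 : z * z = 1 by rewrite -expgD -[2 + 2]ox expg_order.
have z_x : commute x z by apply: commuteX.
have z_y : commute y z by rewrite -y2z; apply: commuteX.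
have zX (t a : bool) : x ^+ a * z ^+ t = z ^+ t * x ^+ a by apply: commuteX2.
have zY (t b : bool) : y ^+ b * z ^+ t = z ^+ t * y ^+ b by apply: commuteX2.
have mulZ (s t : bool) : z ^+ s * z ^+ t = z ^+ (s (+) t).
  by case: s t => [] []; rewrite ?mulg1 ?mul1g.
have mulX (a b : bool) : x ^+ a * x ^+ b = z ^+ (a && b) * x ^+ (a (+) b).
  by case: a b => [] []; rewrite ?mulg1 ?mul1g.
have mulY (a b : bool) : y ^+ a * y ^+ b = z ^+ (a && b) * y ^+ (a (+) b).
  by case: a b => [] []; rewrite ?mulg1 ?mul1g // expg1 -/(y ^+ 2) y2z.
have mulYX (b a : bool) : y ^+ b * x ^+ a = z ^+ (b && a) * x ^+ a * y ^+ b.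
  case: a b => [] []; rewrite ?mulg1 ?mul1g // !expg1.
  rewrite -z_x -[RHS]mulgA -z_y [RHS]mulgA (conjgC x y) xy.
  by rewrite /z expgS mulgA mulgKV expg1.
have fM : {morph quat_to x y : u v / u * v}.
  move=> [[[s a] b] c] [[[s' a'] b'] c']; congr (_, _); last first.
    by apply: val_inj; case: c c' => [] [].
  rewrite -!mulZ.
  have zXA g (t e : bool) : g * x ^+ e * z ^+ t = g * z ^+ t * x ^+ e.
    by rewrite -mulgA zX mulgA.
  have zYA g (t e : bool) : g * y ^+ e * z ^+ t = g * z ^+ t * y ^+ e.
    by rewrite -mulgA zY mulgA.
  have mulXA g (d e : bool) :
      g * x ^+ d * x ^+ e = g * z ^+ (d && e) * x ^+ (d (+) e).
    by rewrite -mulgA mulX mulgA.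
  have mulYA g (d e : bool) :
      g * y ^+ d * y ^+ e = g * z ^+ (d && e) * y ^+ (d (+) e).
    by rewrite -mulgA mulY mulgA.
  have mulYXA g (d e : bool) :
      g * y ^+ d * x ^+ e = g * z ^+ (d && e) * x ^+ e * y ^+ d.
    by rewrite -mulgA mulYX !mulgA.
  rewrite /= -/z !mulgA zYA zXA mulYXA zXA mulXA mulYA zXA; congr (_ * _ * _).
  rewrite -!mulgA; do 2!congr (_ * _).
  by rewrite !mulZ addbA addbC.
have f_ker u : quat_to x y u = 1 -> u = 1.
  case: u => [[[s a] b] c] [].
  case: c => //; case: b => [yE _ | ].
    case/negP: X'y; rewrite -(mulKg (z ^+ s * x ^+ a) y) yE mulg1.
    by rewrite groupV groupM ?groupX ?cycle_id.
  rewrite mulg1 -expgM -expgD => /eqP; rewrite -order_dvdn ox.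
  by case: s a => [] [].
exists (quat_to x y) => //; apply: inj_card_bij => [u v eq_uv|].
  apply: (mulgI u^-1); rewrite mulVg; apply/esym/f_ker.
  by rewrite fM (morph_invg fM) eq_uv mulVg.
by rewrite card_quat card_prod -cardsT oQ card_ord.
Qed.

Theorem mainTheorem2 :
  cayley_index ('Q_8 * 'Z_2)%type = 16 /\
  is_MRR ('Q_8 * 'Z_2)%type
    (graph_cartprod
       (graph_compl
          (graph_cartprod (@cycle_graph 4) (graph_compl (@complete_graph 2))))
       (@complete_graph 2)).
Proof.
have [f bij_f fM] := quat_iso.
split; first by rewrite (eq_cayley_index_iso bij_f fM) cayley_index_quat.
apply: (is_MRR_iso bij_f fM); split; first by rewrite cayley_index_quat.
exists mrr_set; rewrite cayley_index_quat; split.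
- exact: mrr_set_connection.
- exact: mrr_graph_isom.
- exact: cayley_graph_index_mrr.
Qed.
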